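(* Let $N\geq 2$ and $M\geq 1$ be integers and let $L_1,\dots,L_M \in \mathbb{Z}[X_1,\dots,X_N]$ be non-zero linear forms, each having relatively prime coefficients. Then there exists $\boldsymbol{x} \in \mathbb{Z}^N$ such that $L_i(\boldsymbol{x}) \neq 0$ for every $i=1,\dots,M$ and $$H(\boldsymbol{x}) \leq \sum_{i=1}^M \frac{1}{H(L_i)} + \sqrt{M}.$$
   Context: For $\boldsymbol{x}=(x_1,\dots,x_N)\in\mathbb{Z}^N$, the height is $H(\boldsymbol{x})=\max_{1\leq i\leq N}|x_i|$. A linear form is a homogeneous polynomial $L=\sum_{i=1}^N q_iX_i$; its height is the height of its coefficient vector, $H(L)=\max_{1\leq i\leq N}|q_i|$. Relatively prime coefficients means $\gcd(q_1,\dots,q_N)=1$. *)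

(* Defs.v *)
From mathcomp Require Export all_boot all_order all_algebra.
From mathcomp Require Export mpoly.

Set Implicit Arguments.
Unset Strict Implicit.
Unset Printing Implicit Defensive.

Import Order.TTheory GRing.Theory Num.Theory.
Local Open Scope ring_scope.

Definition height (N : nat) (x : 'I_N -> int) : nat := \max_(i < N) `|x i|%N.

(* The zero polynomial is homogeneous of every degree, so it is a linear form. *)
Definition linear_form (N : nat) (L : {mpoly int[N]}) : Prop := L \is 1.-homog.

Definition form_coef (N : nat) (L : {mpoly int[N]}) (i : 'I_N) : int := L@_(U_(i)).

Definition form_height (N : nat) (L : {mpoly int[N]}) : nat := height (form_coef L).

Definition coprime_coefs (N : nat) (L : {mpoly int[N]}) : Prop :=
  \big[gcdz/0]_(i < N) form_coef L i = 1.

(* Main.v *)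
(** Let [S] be the sum of the [1 / H(L_i)] and [B] the integer part of
    [S + sqrt M].  A hyperplane [L = 0] with [h = H(L)] contains at most
    [(2B/h + 1) (2B+1)^(N-2)] of the [(2B+1)^N] integer points of the cube
    [[-B, B]^N]: the coordinate with coefficient [h] or [-h] is determined by the
    others, and these satisfy a congruence modulo [h] with coprime data, which is
    solved coordinate by coordinate.  The [M] hyperplanes therefore do not cover
    the cube as soon as [2BS + M < (2B+1)^2], and this follows from
    [S + sqrt M < B + 1]. *)
Require Import Defs.
From mathcomp Require Import zify ring lra.

Set Implicit Arguments.
Unset Strict Implicit.
Unset Printing Implicit Defensive.

Import Order.TTheory GRing.Theory Num.Theory.
Local Open Scope ring_scope.

Definition drop_coord (T : Type) (k : nat) (j : 'I_k.+1)
    (x : {ffun 'I_k.+1 -> T}) : {ffun 'I_k -> T} :=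
  [ffun i => x (lift j i)].

Lemma drop_coord_inj (T : Type) (k : nat) (j : 'I_k.+1)
    (x y : {ffun 'I_k.+1 -> T}) :
  x j = y j -> drop_coord j x = drop_coord j y -> x = y.
Proof.
move=> xyj /ffunP xy; apply/ffunP => i.
by case: (unliftP j i) => [i' ->|->//]; have := xy i'; rewrite !ffunE.
Qed.

(** Slice [A] by the value of coordinate [j]; on each slice [drop_coord j] is injective. *)
Lemma card_drop_coord (T : finType) (k : nat) (j : 'I_k.+1)
    (A : {set {ffun 'I_k.+1 -> T}}) (B : T -> {set {ffun 'I_k -> T}}) :
  (forall x, x \in A -> drop_coord j x \in B (x j)) ->
  (#|A| <= \sum_t #|B t|)%N.
Proof.
move=> AB; rewrite -sum1_card (partition_big (fun x : {ffun 'I_k.+1 -> T} => x j) xpredT) //=.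
apply: leq_sum => t _; rewrite sum1dep_card.
rewrite -(card_in_imset (f := drop_coord j)); last first.
  move=> x y; rewrite !inE => /andP[_ /eqP xt] /andP[_ /eqP yt].
  by apply: drop_coord_inj; rewrite xt yt.
apply/subset_leq_card/subsetP => _ /imsetP[x + ->].
by rewrite inE => /andP[/AB + /eqP <-].
Qed.

(** As [a] is invertible modulo [g], all solutions are congruent modulo [g], so the quotient
    [x %/ g] separates them and takes at most [n %/ g + 1] values. *)
Lemma card_residue (n g : nat) (a c : int) : (0 < g)%N -> coprime g `|a| ->
  (g * #|[set x : 'I_n.+1 | (g%:Z %| (c + a * (x : nat)%:Z)%R)%Z]| <= n + g)%N.
Proof.
move=> g0 cop; set A := [set x | _].
have Acong x y : x \in A -> y \in A -> (x = y %[mod g])%N.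
  rewrite !inE => xA yA.
  have : (g%:Z %| a * ((x : nat)%:Z - (y : nat)%:Z))%Z.
    by rewrite (_ : _ * _ = (c + a * (x : nat)%:Z) - (c + a * (y : nat)%:Z));
      [exact: rpredB | ring].
  by rewrite Gauss_dvdzr // -eqz_mod_dvd !modz_nat => /eqP [].
have quo_lt (x : 'I_n.+1) : (x %/ g < (n %/ g).+1)%N.
  by rewrite ltnS leq_div2r // -ltnS.
have /leq_card_in : {in A &, injective (fun x => Ordinal (quo_lt x))}.
  move=> x y xA yA /(congr1 val) /= xy; apply: val_inj => /=.
  by rewrite (divn_eq x g) (divn_eq y g) xy (Acong x y).
rewrite card_ord => leA; rewrite (leq_trans (leq_mul (leqnn g) leA)) //.
by rewrite mulnS mulnC addnC leq_add2r leq_divM.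
Qed.

(* By induction on [k]: with [g] the gcd of [h] and all coefficients but the
   first, the first coordinate lies in one residue class modulo [g], and once it
   is fixed the others satisfy a congruence modulo [h %/ g]. *)
Lemma card_congruence (n k h : nat) (q : 'I_k -> int) (c : int) : (0 < h)%N ->
  coprime h (\big[gcdn/0]_(i < k) `|q i|)%N ->
  (h * n.+1 *
     #|[set x : {ffun 'I_k -> 'I_n.+1} |
         (h%:Z %| (c + \sum_i q i * (x i : nat)%:Z)%R)%Z]|
   <= (n + h) * n.+1 ^ k)%N.
Proof.
elim: k h q c => [|k IHk] h q c h0.
  (* The empty gcd is 0, so coprimality forces [h = 1]. *)
  rewrite big_ord0 /coprime gcdn0 => /eqP ->.
  rewrite expn0 mul1n muln1 addn1 -[leqRHS]muln1 leq_mul2l /=.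
  by apply: leq_trans (max_card _) _; rewrite card_ffun !card_ord expn0.
rewrite big_ord_recl; set G := (\big[gcdn/0]_(i < k) _)%N => cop.
set A := [set x | _]; pose g := gcdn h G.
have g0 : (0 < g)%N by rewrite gcdn_gt0 h0.
have [h' hE] : exists h', h = (h' * g)%N.
  by exists (h %/ g)%N; rewrite divnK // dvdn_gcdl.
have h'0 : (0 < h')%N by move: h0; rewrite hE muln_gt0 => /andP[].
have copg : coprime g `|q ord0| by rewrite /coprime -gcdnA [gcdn G _]gcdnC.
have gq i : (g%:Z %| q (lift ord0 i))%Z.
  rewrite dvdzE /= (dvdn_trans (dvdn_gcdr _ _)) //.
  exact: (dvdn_biggcdP xpredT _ _ (dvdnn _)).
pose q' i := (q (lift ord0 i) %/ g%:Z)%Z.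
have q'E i : q (lift ord0 i) = q' i * g%:Z by rewrite divzK.
(* If [d] divides [h'] and every [q' i], then [d * g] divides [h] and [G], hence [g], so [d = 1]. *)
have copq' : coprime h' (\big[gcdn/0]_(i < k) `|q' i|)%N.
  rewrite /coprime; set d := gcdn _ _.
  suff : (d * g %| gcdn h G)%N.
    by rewrite -/g -{2}[g]mul1n dvdn_pmul2r // dvdn1.
  rewrite dvdn_gcd {1}hE dvdn_pmul2r // dvdn_gcdl /=.
  apply/dvdn_biggcdP => i _; rewrite q'E abszM /= dvdn_pmul2r //.
  rewrite (dvdn_trans (dvdn_gcdr _ _)) //.
  exact: (dvdn_biggcdP xpredT _ _ (dvdnn _)).
pose c' (t : 'I_n.+1) := c + q ord0 * (t : nat)%:Z.
(* The constant [c' t] absorbs the fixed first coordinate. If [g] does not divide it, the slice is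
   empty, because [g] divides [h] and all the remaining terms. *)
pose B t := if (g%:Z %| c' t)%Z then
  [set y : {ffun 'I_k -> 'I_n.+1} |
    (h'%:Z %| (c' t %/ g%:Z)%Z + \sum_i q' i * (y i : nat)%:Z)%Z] else set0.
have AB x : x \in A -> drop_coord ord0 x \in B (x ord0).
  rewrite inE big_ord_recl addrA -/(c' _).
  under eq_bigr do rewrite q'E mulrAC.
  rewrite -mulr_suml hE PoszM => hx.
  have gc : (g%:Z %| c' (x ord0))%Z.
    by have := dvdz_trans (dvdz_mull _ (dvdzz _)) hx; rewrite rpredDr // dvdz_mull.
  rewrite /B gc inE.
  move: hx; rewrite -{1}(divzK gc) -mulrDl dvdz_mul2r; last by rewrite -lt0n.
  by under [X in _ -> is_true (_ %| _ + X)%Z]eq_bigr do rewrite ffunE.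
have leA := card_drop_coord AB.
pose C := [set t : 'I_n.+1 | (g%:Z %| c' t)%Z].
have leB : (h' * n.+1 * \sum_t #|B t| <= #|C| * ((n + h') * n.+1 ^ k))%N.
  rewrite big_distrr /= -sum1_card big_distrl /= [leqRHS]big_mkcond /=.
  apply: leq_sum => t _; rewrite /B inE.
  by case: ifP => _; rewrite ?mul1n ?cards0 ?muln0 ?IHk.
have leC : (g * #|C| <= n + g)%N by apply: card_residue.
apply: (@leq_trans (g * (h' * n.+1 * \sum_t #|B t|))).
  by rewrite hE -!mulnA mulnCA !leq_mul2l leA !orbT.
apply: (@leq_trans (g * (#|C| * ((n + h') * n.+1 ^ k)))).
  by rewrite leq_mul2l leB orbT.
rewrite mulnA; apply: (@leq_trans ((n + g) * ((n + h') * n.+1 ^ k))).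
  by rewrite leq_mul2r leC orbT.
rewrite expnS !mulnA leq_mul2r hE; apply/orP; right.
(* After expansion and cancellation the goal is [n] times [g + h' <= h' * g + 1], that is
   [(g - 1) * (h' - 1) >= 0]. *)
have : (n * (g + h') <= n * (h' * g).+1)%N.
  by rewrite leq_mul2l; apply/orP; right; nia.
by lia.
Qed.

Lemma height_gt0 (N : nat) (q : 'I_N -> int) :
  (\big[gcdn/0]_(i < N) `|q i| = 1)%N -> (0 < height q)%N.
Proof.
move=> gcd1; rewrite lt0n; apply/eqP => h0.
suff : (0 %| \big[gcdn/0]_(i < N) `|q i|)%N by rewrite gcd1.
apply/dvdn_biggcdP => i _; rewrite dvd0n -leqn0 -h0.
exact: (@leq_bigmax _ (fun i => `|q i|%N)).
Qed.

(* The coordinate carrying the largest coefficient [h] is determined by the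
   others, which satisfy a congruence modulo [h]. *)
Lemma card_hyperplane (n k : nat) (q : 'I_k.+1 -> int) (c : int) :
  (\big[gcdn/0]_(i < k.+1) `|q i| = 1)%N ->
  (height q * n.+1 *
     #|[set x : {ffun 'I_k.+1 -> 'I_n.+1} |
         (c + \sum_i q i * (x i : nat)%:Z == 0)%R]|
   <= (n + height q) * n.+1 ^ k)%N.
Proof.
move=> gcd1; set A := [set x | _].
have [j hE] : {j | height q = `|q j|%N} by apply: bigop.eq_bigmax; rewrite card_ord.
have h0 := height_gt0 gcd1.
have cop : coprime (height q) (\big[gcdn/0]_(i < k) `|q (lift j i)|)%N.
  rewrite /coprime -dvdn1 -gcd1; apply/dvdn_biggcdP => i _.
  case: (unliftP j i) => [i' ->|->]; last by rewrite -hE dvdn_gcdl.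
  rewrite (dvdn_trans (dvdn_gcdr _ _)) //.
  exact: (dvdn_biggcdP xpredT _ _ (dvdnn _)).
have := card_congruence n c h0 cop; set B := [set x | _].
apply: leq_trans; rewrite leq_mul2l; apply/orP; right.
have sumE (x : {ffun 'I_k.+1 -> 'I_n.+1}) : \sum_i q i * (x i : nat)%:Z =
    q j * (x j : nat)%:Z + \sum_i q (lift j i) * (drop_coord j x i : nat)%:Z.
  rewrite (bigD1_ord j) //=; congr (_ + _).
  by apply: eq_bigr => i _; rewrite ffunE.
rewrite -(card_in_imset (f := drop_coord j)); last first.
  move=> x y; rewrite !inE !sumE => /eqP xA /eqP yA xy.
  apply: (drop_coord_inj _ xy); apply: val_inj; apply/eqP.
  have : q j * (x j : nat)%:Z = q j * (y j : nat)%:Z.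
    apply: (@addIr _ (\sum_i q (lift j i) * (drop_coord j y i : nat)%:Z)).
    by apply: (@addrI _ c); rewrite yA -xy.
  by rewrite -eqz_nat => /mulfI ->//; rewrite -absz_gt0 -hE.
apply/subset_leq_card/subsetP => _ /imsetP[x + ->].
rewrite !inE sumE => /eqP xA.
rewrite (_ : c + _ = - (q j * (x j : nat)%:Z)); last first.
  by apply/eqP; rewrite -addr_eq0 -addrA [X in c + X]addrC xA.
by rewrite dvdzE hE abszN abszM dvdn_mulr.
Qed.

Lemma exists_notin_family (T I : finType) (A : I -> {set T}) :
  (\sum_i #|A i| < #|T|)%N -> exists x, forall i, x \notin A i.
Proof.
move=> ltA; suff /existsP[x /forallP] : [exists x, forall i, x \notin A i].
  by exists x.
apply: contraLR ltA; rewrite -leqNgt => /existsPn cover.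
(* Double counting: summed over points instead of sets, each covered point contributes at least
   1. *)
under [leqRHS]eq_bigr do rewrite -sum1_card big_mkcond.
rewrite exchange_big /= -sum1_card; apply: leq_sum => x _.
have /forallPn[i] := cover x.
by rewrite negbK (bigD1 i) //= => ->.
Qed.

Lemma meval_linear_form (N : nat) (L : {mpoly int[N]}) (x : 'I_N -> int) :
  linear_form L -> L.@[x] = \sum_i form_coef L i * x i.
Proof.
move=> homL; suff {1}-> : L = \sum_i form_coef L i *: 'X_i.
  by rewrite raddf_sum; apply: eq_bigr => i _ /=; rewrite mevalZ mevalXU.
(* Compare coefficients: homogeneity leaves only the monomials of degree 1, which are the
   [U_(i)]. *)
apply/mpolyP => m; rewrite raddf_sum /=.
under eq_bigr do rewrite mcoeffZ mcoeffX.
have [/mdeg1P[i /eqP ->]|degm] := boolP (mdeg m == 1%N).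
  rewrite (bigD1 i) //= eqxx mulr1 big1 ?addr0 // => j ji.
  by rewrite eq_mnm1 (negbTE ji) mulr0.
rewrite (dhomog_nemf_coeff homL degm) big1 // => i _.
by case: (U_(i)%MM =P m) degm => [<-|_ _]; rewrite ?mdeg1 ?mulr0.
Qed.

Lemma coprime_coefs_nat (N : nat) (L : {mpoly int[N]}) :
  coprime_coefs L -> (\big[gcdn/0]_(i < N) `|form_coef L i| = 1)%N.
Proof.
move=> copL; rewrite -[RHS](congr1 absz copL).
by rewrite (big_morph absz (id1 := 0%N) (op1 := gcdn)).
Qed.

(** [R] need not be archimedean, so the explicit bound [b] is what makes an integer part exist. *)
Lemma natr_floor_exists (R : realDomainType) (T : R) (b : nat) :
  0 <= T <= b%:R -> exists B : nat, B%:R <= T < B.+1%:R.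
Proof.
move=> /andP[T0 Tb].
have exB : exists n : nat, n%:R <= T by exists 0%N.
have ubB n : n%:R <= T -> (n <= b)%N.
  by move=> nT; rewrite -(ler_nat R) (le_trans nT).
case: (ex_maxnP exB ubB) => B BT maxB; exists B; rewrite BT ltNge.
by apply/negP => /maxB; rewrite ltnn.
Qed.

Theorem corollary5p1 (R : rcfType) (N M : nat) (hN : (2 <= N)%N) (hM : (1 <= M)%N)
    (L : 'I_M -> {mpoly int[N]})
    (hL : forall i : 'I_M, linear_form (L i))
    (hL0 : forall i : 'I_M, L i != 0)
    (hLcop : forall i : 'I_M, coprime_coefs (L i)) :
  exists x : 'I_N -> int,
    (forall i : 'I_M, (L i).@[x] != 0) /\
    (height x)%:R <= \sum_(i < M) ((form_height (L i))%:R)^-1 + Num.sqrt (M%:R) :> R.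
Proof.
case: N hN L hL hL0 hLcop => // k _ L hL _ hLcop.
set S := \sum_(i < M) _; set s := Num.sqrt _.
have s0 : 0 <= s := sqrtr_ge0 _.
have s2 : s ^+ 2 = M%:R by rewrite sqr_sqrtr.
have S0 : 0 <= S by apply: sumr_ge0 => i _; rewrite invr_ge0.
have h0 i : (0 < form_height (L i))%N.
  exact/height_gt0/coprime_coefs_nat/hLcop.
(* Together with [s <= M], this gives the natural bound [M + M] needed to take the integer part of
   [S + s]. *)
have SM : S <= M%:R.
  rewrite -[M in leRHS]card_ord -sumr_const.
  by apply: ler_sum => i _; rewrite invf_le1 ?ltr0n // ler1n.
have M1 : 1 <= M%:R :> R by rewrite ler1n.
have sM : s <= M%:R.
  have s1 : 1 <= s by rewrite -(@ler_pXn2r _ 2) ?nnegrE // s2 expr1n.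
  by rewrite -s2 ler_eXnr.
have [B /andP[BT TB]] : exists B : nat, B%:R <= S + s < B.+1%:R.
  apply: (@natr_floor_exists _ _ (M + M)%N).
  by rewrite addr_ge0 // natrD lerD.
(* The cube is translated by [B] so that its coordinates range over ['I_n.+1]; the constant [c i]
   compensates for the translation. *)
pose n := (B + B)%N.
pose c i := - \sum_j form_coef (L i) j * B%:Z.
pose A i := [set x : {ffun 'I_k.+1 -> 'I_n.+1} |
         c i + \sum_j form_coef (L i) j * (x j : nat)%:Z == 0].
have ltA : (\sum_i #|A i| < #|{ffun 'I_k.+1 -> 'I_n.+1}|)%N.
  rewrite card_ffun !card_ord -(ltr_nat R) -(ltr_pM2l (ltr0Sn R n)).
  rewrite natr_sum mulr_sumr.
  have leA i : n.+1%:R * #|A i|%:R <=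
      (n%:R * (form_height (L i))%:R^-1 + 1) * (n.+1 ^ k)%:R :> R.
    have hR : 0 < (form_height (L i))%:R :> R by rewrite ltr0n.
    rewrite -(ler_pM2l hR) !mulrA mulrDr mulr1 mulrCA divff ?gt_eqF // mulr1.
    rewrite -!natrM -natrD -natrM ler_nat.
    exact: (card_hyperplane n (c i) (coprime_coefs_nat (hLcop i))).
  apply: le_lt_trans (ler_sum _ (fun i _ => leA i)) _.
  rewrite -mulr_suml big_split /= -mulr_sumr sumr_const card_ord -/S.
  rewrite expnS natrM mulrA ltr_pM2r ?ltr0n ?expn_gt0 // -s2.
  (* What remains is [2BS + s^2 < (2B+1)^2]. Since [s < B+1], the left side is at most
     [(2B+1)(S+s)], which is less than [(2B+1)(B+1)]. *)
  move: TB; rewrite /n -!natr1 natrD => TB.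
  have B0 : 0 <= B%:R :> R by [].
  nra.
have [x xA] := exists_notin_family ltA.
exists (fun j => (x j : nat)%:Z - B%:Z); split=> [i|].
  have := xA i; rewrite inE; apply: contraNN => /eqP xi; apply/eqP.
  rewrite -[RHS]xi meval_linear_form // /c addrC -sumrB.
  by apply: eq_bigr => j _; rewrite mulrBr.
apply: le_trans BT; rewrite ler_nat; apply/bigmax_leqP => j _.
by have := ltn_ord (x j); rewrite /n; lia.
Qed.
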